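(* Let $A\in\mathbb{R}^{n\times n}$ be symmetric positive semi-definite and let $V\in\mathbb{R}^{n\times r}$ have orthonormal columns. Let $J$ be the random index set returned by Adaptive Randomized Pivoting (ARP) applied to $V$, and assume that $A(J,J)$ is invertible with probability one. Then $$\mathbb{E}[\|A-A(:,J)A(J,J)^{-1}A(J,:)\|_*]\le (r+1)\,\|(\mathrm{Id}-VV^T)A(\mathrm{Id}-VV^T)\|_* .$$
   Context: $\|\cdot\|_*$ is the nuclear norm (the sum of the singular values). For an index tuple $J$, $A(:,J)$, $A(J,:)$, $A(J,J)$ denote the submatrices of $A$ with columns $J$, with rows $J$, and with rows and columns $J$, respectively. Adaptive Randomized Pivoting (ARP). Input: $V\in\mathbb{R}^{n\times r}$ with orthonormal columns. Set $W_0=V$. For $k=1,\ldots,r$: set $p_j=\|W_{k-1}(j,k:r)\|_2^2/(r-k+1)$ for $j=1,\ldots,n$ (a probability distribution on $\{1,\dots,n\}$), where $W_{k-1}(j,k:r)$ is row $j$ restricted to columns $k,\ldots,r$; sample $j_k$ according to the probabilities $p_j$; set $W_k=W_{k-1}Q_k$, where $Q_k=\mathrm{diag}(\mathrm{Id}_{k-1},H_k)\in\mathbb{R}^{r\times r}$ and $H_k\in\mathbb{R}^{(r-k+1)\times(r-k+1)}$ is a Householder reflector $\mathrm{Id}-2u_ku_k^T$ with a unit vector $u_k$ (or the identity, if there is nothing to annihilate), chosen such that $W_{k-1}(j_k,k:r)H_k$ is a multiple of the first unit row vector, i.e. $W_k(j_k,k+1:r)=0$. Output: $J=(j_1,\ldots,j_r)$.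 With probability one, the indices are distinct and $V(J,:)$ is invertible. *)

(* Defs.v *)
From HB Require Import structures.
From mathcomp Require Import all_boot all_order all_algebra.
From mathcomp Require Import complex.
From mathcomp Require Import all_classical all_reals all_analysis.

Set Implicit Arguments.
Unset Strict Implicit.
Unset Printing Implicit Defensive.

Import Order.TTheory GRing.Theory Num.Theory.

Local Open Scope classical_set_scope.
Local Open Scope ring_scope.

Definition psdmx (R : realType) (n : nat) (A : 'M[R]_n) : Prop :=
  A^T = A /\ forall x : 'cV[R]_n, 0 <= (x^T *m A *m x) ord0 ord0.

Definition orthonormal_cols (R : realType) (n r : nat) (V : 'M[R]_(n, r)) :
  Prop := V^T *m V = 1%:M.

(* The square roots of the eigenvalues of [M^T M], listed with multiplicity.
   [spectral_diag] needs a closed field, hence the detour through [R[i]]; the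
   eigenvalues are real since [M^T M] is symmetric.  For [m < n] the list is
   the usual one padded with zeros. *)
Definition singular_values (R : realType) (m n : nat) (M : 'M[R]_(m, n)) :
    'rV[R]_n :=
  \row_i Num.sqrt
    (complex.Re (spectral_diag (map_mx (real_complex R) (M^T *m M)) ord0 i)).

Lemma char_poly_singular_values (R : realType) m n (M : 'M[R]_(m, n)) :
  char_poly (M^T *m M) = \prod_i ('X - ((singular_values M ord0 i) ^+ 2)%:P).
Proof.
set N := M^T *m M.
pose f := real_complex R.
pose B := map_mx f N.
have Bt : map_mx Num.conj (map_mx f M) = map_mx f M.
  by apply/matrixP => i j; rewrite !mxE; rewrite /Num.conj /= oppr0.
have BE : B = (map_mx Num.conj (map_mx f M))^T *m map_mx f M.
  by rewrite Bt /B map_mxM map_trmx.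
have Bn : B \is normalmx.
  have E : map_mx Num.conj (B^T) = B.
    by rewrite BE Bt trmx_mul trmxK map_mxM -map_trmx map_trmx Bt -map_trmx Bt.
  by apply/normalmxP; rewrite E.
have /orthomx_spectralP BS := Bn.
set U := spectralmx B in BS; set D := spectral_diag B in BS.
have Uu : U \is unitarymx by apply: spectral_unitarymx.
have Ui := invmx_unitary Uu.
have UU : U \in unitmx by apply: unitarymx_unit.
have DE : diag_mx D = U *m B *m invmx U.
  by rewrite [in RHS]BS !mulmxA mulmxV // mul1mx mulmxK.
pose Z := map_mx f M *m invmx U.
have DZ : diag_mx D = (map_mx Num.conj Z)^T *m Z.
  rewrite DE BE /Z Ui map_mxM trmx_mul !mulmxA; congr (_ *m _ *m _ *m _).
  by rewrite -!map_trmx trmxK -map_mx_comp map_mx_id // => x; exact: conjCK.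
have D0 i : 0 <= D ord0 i.
  have /matrixP/(_ i i) := DZ; rewrite !mxE eqxx mulr1n => ->.
  by apply: sumr_ge0 => k _; rewrite !mxE mulrC; exact: mul_conjC_ge0.
have sE i : f (singular_values M ord0 i ^+ 2) = D ord0 i.
  rewrite mxE -/N -/f -/B -/D.
  have := D0 i; case: (D ord0 i) => a b; rewrite lecE /= => /andP[/eqP -> a0].
  by rewrite sqr_sqrtr.
apply: (map_poly_inj f); rewrite map_char_poly -/B.
have -> : char_poly B = char_poly (diag_mx D).
  rewrite /char_poly /char_poly_mx.
  have -> : 'X%:M - map_mx polyC (diag_mx D) =
    map_mx polyC U *m ('X%:M - map_mx polyC B) *m map_mx polyC (invmx U).
    rewrite DE !map_mxM mulmxBr mulmxBl; congr (_ - _).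
    by rewrite scalar_mxC -mulmxA -map_mxM mulmxV // map_mx1 mulmx1.
  rewrite !det_mulmx mulrAC -det_mulmx -map_mxM mulmxV // map_mx1 det1 mul1r.
  by [].
rewrite char_poly_trig ?diag_mx_is_trig //.
rewrite rmorph_prod /=; apply: eq_bigr => i _.
have -> : diag_mx D i i = D ord0 i by rewrite !mxE eqxx mulr1n.
by rewrite -sE rmorphB /= map_polyX map_polyC.
Qed.

Definition nuclear_norm (R : realType) (m n : nat) (M : 'M[R]_(m, n)) : R :=
  \sum_i singular_values M ord0 i.

Definition is_reflector (R : realType) (m : nat) (H : 'M[R]_m) : Prop :=
  exists2 u : 'cV[R]_m, u^T *m u = 1%:M & H = 1%:M - 2 *: (u *m u^T).

(* [diag(Id_k, H)]; for [k <= r] its size [k + (r - k)] equals [r]. *)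
Definition embed_reflector (R : realType) (r k : nat) (H : 'M[R]_(r - k)) :
    'M[R]_r :=
  conform_mx 1%:M (block_mx (1%:M : 'M[R]_k) 0 0 H).

(* Steps are numbered from 0.  [js] is the sequence of sampled indices, and
   [H k s] is the reflector used in step [k] once the indices [s] (of length
   [k.+1]) have been sampled: the choice of reflector may depend on everything
   that happened so far.  [arp_W H V js k] is the matrix obtained from [V] after
   [k] steps; it only depends on the first [k] entries of [js]. *)
Fixpoint arp_W (R : realType) (n r : nat)
    (H : forall k : nat, seq 'I_n -> 'M[R]_(r - k)) (V : 'M[R]_(n, r))
    (js : seq 'I_n) (k : nat) : 'M[R]_(n, r) :=
  if k is k'.+1 then
    arp_W H V js k' *m embed_reflector (H k' (take k js))
  else V.

Definition arp_prob (R : realType) (n r : nat) (W : 'M[R]_(n, r)) (k : nat)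
    (j : 'I_n) : R :=
  (\sum_(l < r | (k <= l)%N) W j l ^+ 2) / (r - k)%:R.

Definition arp_reflectors (R : realType) (n r : nat) (V : 'M[R]_(n, r))
    (H : forall k : nat, seq 'I_n -> 'M[R]_(r - k)) : Prop :=
  forall (js : seq 'I_n) (j : 'I_n), (size js < r)%N ->
    let k := size js in let s := rcons js j in
    (H k s = 1%:M \/ is_reflector (H k s)) /\
    (forall l : 'I_r, (k < l)%N -> arp_W H V s k.+1 j l = 0).

(* The law of the random index tuple is prescribed through its conditional
   probabilities, written in product form so that histories of probability zero
   need no special treatment. *)
Definition arp_output (R : realType) (d : measure_display)
    (T : measurableType d) (P : probability T R) (n r : nat)
    (V : 'M[R]_(n, r)) (J : T -> r.-tuple 'I_n) : Prop :=
  (forall s : r.-tuple 'I_n, measurable (J @^-1` [set s])) /\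
  exists2 H : (forall k : nat, seq 'I_n -> 'M[R]_(r - k)),
    arp_reflectors V H &
    forall (js : seq 'I_n) (j : 'I_n), (size js < r)%N ->
      let k := size js in
      P [set w | take k.+1 (J w) = rcons js j] =
      (P [set w | take k (J w) = js] * (arp_prob (arp_W H V js k) k j)%:E)%E.

Section submatrices.
Context {R : realType} {n r : nat}.
Implicit Types (A : 'M[R]_n) (J : r.-tuple 'I_n).

Definition cols_of A J : 'M[R]_(n, r) := colsub (tnth J) A.
Definition rows_of A J : 'M[R]_(r, n) := rowsub (tnth J) A.
Definition principal_of A J : 'M[R]_r := mxsub (tnth J) (tnth J) A.

End submatrices.

(* Main.v *)
(* Write Q = Id - V V^T.  After k steps of ARP the rows of W_k sampled so far
   are lower triangular, and the squared pivots are, up to normalisation, the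
   conditional probabilities.  As W_r = V U with U orthogonal, this gives
   P(J = s) = det(V(s,:))^2 / r! for every tuple s, whatever the reflectors.
   Let S consist of the columns s of Id.  The residual is the positive
   semi-definite minimum over X of (Id - S X)^T A (Id - S X), so its nuclear
   norm is its trace, which is at most the trace for X = V(s,:)^-T V^T.  For
   this X the range of Id - S X lies in that of Q, and the trace is
   tr(QAQ) + tr(V(s,:)^-1 (QAQ)(s,s) V(s,:)^-T).  Multiplied by
   det(V(s,:))^2, the second term is by Cramer's rule a combination of products
   of minors of V with one column replaced by a column of Q, and Cauchy-Binet
   sums these over s to r! r tr(QAQ). *)
Require Import Defs.
From HB Require Import structures.
From mathcomp Require Import all_boot all_order all_algebra.
From mathcomp Require Import perm complex ring.
From mathcomp Require Import all_classical all_reals all_analysis.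
From mathcomp Require Import measurable_realfun.

Set Implicit Arguments.
Unset Strict Implicit.
Unset Printing Implicit Defensive.

Import Order.TTheory GRing.Theory Num.Theory.

Local Open Scope classical_set_scope.
Local Open Scope ring_scope.

(** * Minors summed over all index tuples: Cauchy-Binet and Cramer *)

(** The sum runs over ordered tuples, repetitions included: tuples with a repeated index contribute
    zero, and each index set is counted once per ordering, whence the factor [r!]. *)
Lemma cauchy_binet_tuple (R : comNzRingType) (n r : nat) (X Y : 'M[R]_(n, r)) :
  \sum_(s : r.-tuple 'I_n)
     \det (rowsub (tnth s) X) * \det (rowsub (tnth s) Y)
  = (r`!)%:R * \det (X^T *m Y).
Proof.
pose F (f : 'I_r -> 'I_n) := \det (rowsub f X) * \det (rowsub f Y).
have -> : \sum_(s : r.-tuple 'I_n) F (tnth s) =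
          \sum_(f : {ffun 'I_r -> 'I_n}) F f.
  rewrite (reindex (fun f : {ffun 'I_r -> 'I_n} => [tuple f i | i < r])) /=.
    apply: eq_bigr => f _; rewrite /F.
    by rewrite !(eq_rowsub f) // => i; rewrite tnth_mktuple.
  exists (fun s : r.-tuple 'I_n => [ffun i => tnth s i]) => s _.
    by apply/ffunP => i; rewrite ffunE tnth_mktuple.
  by apply: eq_from_tnth => i; rewrite tnth_mktuple ffunE.
(* One Leibniz term of the first determinant at a time: by distributivity, summing over [f]
   assembles the determinant of [X^T *m Y] with its rows permuted by [sg]. The sign produced here
   cancels the Leibniz sign. *)
have step (sg : 'S_r) : \sum_(f : {ffun 'I_r -> 'I_n})
    (\prod_k X (f k) (sg k)) * \det (rowsub f Y) = (-1) ^+ sg * \det (X^T *m Y).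
  rewrite -det_perm -det_mulmx -row_permE.
  under eq_bigr => f _ do rewrite /determinant mulr_sumr.
  rewrite exchange_big; apply: eq_bigr => t _ /=.
  under eq_bigr => f _ do
    (rewrite mulrCA -big_split /=; under eq_bigr => k _ do rewrite mxE).
  rewrite -mulr_sumr; congr (_ * _).
  rewrite -(bigA_distr_bigA (fun k j => X j (sg k) * Y j (t k))).
  apply: eq_bigr => k _; rewrite !mxE.
  by apply: eq_bigr => j _; rewrite !mxE.
under eq_bigr => f _ do rewrite /F {1}/determinant mulr_suml.
rewrite exchange_big /=.
under eq_bigr => sg _.
  under eq_bigr => f _ do
    (rewrite -mulrA; under eq_bigr => k _ do rewrite mxE).
  rewrite -mulr_sumr step mulrA -expr2 sqrr_sign mul1r.
  over.
by rewrite sumr_const card_Sn mulr_natl.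
Qed.

Definition set_col (R : nzRingType) (n r : nat) (l : 'I_r) (x : 'cV[R]_n)
    (V : 'M[R]_(n, r)) : 'M[R]_(n, r) :=
  \matrix_(i, j) if j == l then x i ord0 else V i j.

(* Cramer's rule *)
Lemma det_set_col (R : comNzRingType) (r : nat) (l : 'I_r) (x : 'cV[R]_r)
    (M : 'M[R]_r) :
  \det (set_col l x M) = (\adj M *m x) l ord0.
Proof.
rewrite (expand_det_col _ l) mxE; apply: eq_bigr => i _.
rewrite !mxE eqxx mulrC; congr (_ * _ * _); congr (\det _).
by apply/matrixP => a b; rewrite !mxE eq_sym (negbTE (neq_lift _ _)).
Qed.

Lemma rowsub_set_col (R : nzRingType) (m n r : nat) (f : 'I_m -> 'I_n)
    (l : 'I_r) (x : 'cV[R]_n) (V : 'M[R]_(n, r)) :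
  rowsub f (set_col l x V) = set_col l (rowsub f x) (rowsub f V).
Proof. by apply/matrixP => i j; rewrite !mxE. Qed.

(** Orthogonality of [x] and [y] to the columns of [V] makes this Gram matrix diagonal, with all
    entries 1 except the one at [l]. *)
Lemma det_gram_set_col (R : comNzRingType) (n r : nat) (l : 'I_r)
    (x y : 'cV[R]_n) (V : 'M[R]_(n, r)) :
  V^T *m V = 1%:M -> V^T *m x = 0 -> V^T *m y = 0 ->
  \det ((set_col l x V)^T *m set_col l y V) = (x^T *m y) ord0 ord0.
Proof.
move=> VV Vx Vy.
have -> : (set_col l x V)^T *m set_col l y V =
    diag_mx (\row_j if j == l then (x^T *m y) ord0 ord0 else 1).
  apply/matrixP => i j; rewrite !mxE.
  under eq_bigr => k _ do rewrite !mxE.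
  have [->|il] := eqVneq i l; have [jl|jl] := eqVneq j l.
  - by rewrite mulr1n; apply: eq_bigr => k _; rewrite mxE.
  - transitivity ((V^T *m x) j ord0); last by rewrite Vx mxE.
    by rewrite mxE; apply: eq_bigr => k _; rewrite !mxE mulrC.
  - rewrite jl (negbTE il).
    transitivity ((V^T *m y) i ord0); last by rewrite Vy mxE.
    by rewrite mxE; apply: eq_bigr => k _; rewrite !mxE.
  - transitivity ((V^T *m V) i j); last by rewrite VV mxE.
    by rewrite mxE; apply: eq_bigr => k _; rewrite !mxE.
rewrite det_diag (bigD1 l) //= mxE eqxx big1 ?mulr1 // => j jl.
by rewrite mxE (negbTE jl).
Qed.

(** By Cramer's rule, entry [(l, a)] of the adjugate times the rows [s] of [Q] is the minor
    [D s l a] of [V] with column [l] replaced by column [a] of [Q]. The trace is thus a quadratic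
    form in these minors, and Cauchy-Binet sums their products over [s]. Every [l] contributes
    equally, which gives the factor [r]. *)
Lemma sum_trace_adj (R : comNzRingType) (n r : nat) (V : 'M[R]_(n, r))
    (Q A : 'M[R]_n) :
  V^T *m V = 1%:M -> V^T *m Q = 0 ->
  \sum_(s : r.-tuple 'I_n)
     \tr (\adj (rowsub (tnth s) V) *m
          mxsub (tnth s) (tnth s) (Q *m A *m Q^T) *m
          (\adj (rowsub (tnth s) V))^T)
  = (r`!)%:R * (r%:R * \tr (Q *m A *m Q^T)).
Proof.
move=> VV VQ.
have Vc a : V^T *m col a Q = 0 by rewrite colE mulmxA VQ mul0mx.
pose D (s : r.-tuple 'I_n) l a :=
  \det (rowsub (tnth s) (set_col l (col a Q) V)).
have E (s : r.-tuple 'I_n) :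
    \tr (\adj (rowsub (tnth s) V) *m
          mxsub (tnth s) (tnth s) (Q *m A *m Q^T) *m
          (\adj (rowsub (tnth s) V))^T) =
    \sum_l \sum_b \sum_a A a b * (D s l a * D s l b).
  set Z := \adj _.
  have DE l a : D s l a = (Z *m rowsub (tnth s) Q) l a.
    rewrite /D rowsub_set_col det_set_col !mxE.
    by apply: eq_bigr => k _; rewrite !mxE.
  have -> : mxsub (tnth s) (tnth s) (Q *m A *m Q^T) =
      rowsub (tnth s) Q *m A *m (rowsub (tnth s) Q)^T.
    by rewrite mxsub_mul -mul_rowsub_mx trmx_mxsub.
  rewrite -!mulmxA -trmx_mul !mulmxA.
  set G := Z *m _ in DE *.
  apply: eq_bigr => l _; rewrite mxE; apply: eq_bigr => b _.
  rewrite [(G *m A) _ _]mxE [G^T _ _]mxE mulr_suml; apply: eq_bigr => a _.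
  by rewrite !DE -mulrA mulrCA.
under eq_bigr => s _ do rewrite E.
rewrite exchange_big /=.
under eq_bigr => l _.
  rewrite exchange_big /=.
  under eq_bigr => b _.
    rewrite exchange_big /=.
    under eq_bigr => a _ do
      rewrite -mulr_sumr cauchy_binet_tuple (det_gram_set_col _ VV) // mulrCA.
    rewrite -mulr_sumr; over.
  rewrite -mulr_sumr; over.
rewrite sumr_const card_ord -[LHS]mulr_natl mulrCA; congr (_ * (_ * _)).
(* The Gram determinants are the entries of [Q^T *m Q]; the remaining double sum is
   [\tr (A *m (Q^T *m Q))], up to cyclicity the trace sought. *)
rewrite -mulmxA mxtrace_mulC -mulmxA exchange_big; apply: eq_bigr => a _ /=.
rewrite mxE; apply: eq_bigr => b _; rewrite !mxE; congr (_ * _).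
by apply: eq_bigr => k _; rewrite !mxE mulrC.
Qed.

(** * Reflectors and the law of the ARP output *)

Lemma reflector_orthogonal (R : realType) (m : nat) (H : 'M[R]_m) :
  is_reflector H -> H^T *m H = 1%:M.
Proof.
case=> u uu ->.
have -> : (1%:M - 2 *: (u *m u^T))^T = 1%:M - 2 *: (u *m u^T).
  by rewrite raddfB /= trmx1 linearZ /= trmx_mul trmxK.
rewrite mulmxBl mul1mx mulmxBr mulmx1 -!scalemxAl -!scalemxAr.
rewrite mulmxA -(mulmxA u) uu mulmx1 scalerA.
rewrite -[X in _ - X]scalerBl -addrA -opprD -scalerDl.
by rewrite (_ : 2 + (2 - 2 * 2) = 0) ?scale0r ?subr0 //; ring.
Qed.

Lemma embed_reflector_orthogonal (R : realType) (r k : nat)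
    (H : 'M[R]_(r - k)) :
  (k <= r)%N -> H^T *m H = 1%:M ->
  (embed_reflector H)^T *m embed_reflector H = 1%:M /\
  forall i j : 'I_r, (i < k)%N || (j < k)%N ->
    embed_reflector H i j = (i == j)%:R.
Proof.
(* With [r - k] generalised to [m], the equation [k + m = r] can be eliminated, and [conform_mx] no
   longer changes the size. *)
move=> kr; rewrite /embed_reflector; move: (r - k)%N (subnKC kr) H => m.
move=> e; case: r / e kr => _ H HH; rewrite conform_mx_id; split.
  rewrite tr_block_mx mulmx_block !trmx1 !trmx0 !mulmx0 !mul0mx !mul1mx HH.
  by rewrite !addr0 !add0r -scalar_mx_block.
move=> i j; case: (splitP i) => [a|a] ia; case: (splitP j) => [b|b] jb.
- have -> : i = lshift m a by exact/val_inj.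
  have -> : j = lshift m b by exact/val_inj.
  by rewrite block_mxEul mxE (inj_eq (@lshift_inj _ _)).
- have -> : i = lshift m a by exact/val_inj.
  have -> : j = rshift k b by exact/val_inj.
  by rewrite block_mxEur mxE eq_lrshift.
- have -> : i = rshift k a by exact/val_inj.
  have -> : j = lshift m b by exact/val_inj.
  by rewrite block_mxEdl mxE eq_rlshift.
- by [].
Qed.

Lemma arp_W_take (R : realType) (n r : nat)
    (H : forall k : nat, seq 'I_n -> 'M[R]_(r - k)) (V : 'M[R]_(n, r))
    (js : seq 'I_n) (k m : nat) :
  (k <= m)%N -> arp_W H V (take m js) k = arp_W H V js k.
Proof.
elim: k => [//|k IH] km; rewrite /= IH ?(ltnW km) //.
by rewrite (@take_takel _ k.+1 m).
Qed.

Section arp_law.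
Variables (R : realType) (d : measure_display) (T : measurableType d).
Variables (P : probability T R) (n r : nat) (V : 'M[R]_(n, r)).
Variable J : T -> r.-tuple 'I_n.
Variable H : forall k : nat, seq 'I_n -> 'M[R]_(r - k).
Hypothesis HR : arp_reflectors V H.
Hypothesis HP : forall (js : seq 'I_n) (j : 'I_n), (size js < r)%N ->
  let k := size js in
  P [set w | take k.+1 (J w) = rcons js j] =
  (P [set w | take k (J w) = js] * (arp_prob (arp_W H V js k) k j)%:E)%E.

(** The three parts form the induction invariant. Each new squared pivot is [r - k] times the
    conditional probability of the sampled index; these normalisations multiply up to the falling
    factorial. *)
Lemma arp_W_law (s : r.-tuple 'I_n) (k : nat) : (k <= r)%N ->
  let W := arp_W H V s k in
  [/\ exists2 Q : 'M[R]_r, Q *m Q^T = 1%:M & W = V *m Q,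
      forall i l : 'I_r, (i < k)%N -> (i < l)%N -> W (tnth s i) l = 0 &
      P [set w | take k (J w) = take k s] =
      ((\prod_(l < r | (l < k)%N) W (tnth s l) l ^+ 2) / (r ^_ k)%:R)%:E ].
Proof.
elim: k => [_|k IH kr] W.
  split=> //; first by exists 1%:M; rewrite ?trmx1 mulmx1.
  rewrite big1 // divr1 -[RHS](@probability_setT _ _ _ P); congr (P _).
  by apply/seteqP; split=> w //= _; rewrite !take0.
have [[Q QQ WQ] W0 PW] := IH (ltnW kr).
set W' := arp_W H V s k in WQ W0 PW.
pose kk := Ordinal kr.
have sk : size (take k s) = k by rewrite size_takel // size_tuple ltnW.
have tkE : rcons (take k s) (tnth s kk) = take k.+1 s.
  by rewrite (tnth_nth (tnth s kk)) /= -take_nth // size_tuple.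
have := @HR (take k s) (tnth s kk); have := @HP (take k s) (tnth s kk).
rewrite sk tkE => /(_ kr) Pk /(_ kr) /= [Hk Wk].
rewrite !arp_W_take // in Pk Wk; rewrite take_takel // in Wk.
have {}Hk : (H k (take k.+1 s))^T *m H k (take k.+1 s) = 1%:M.
  by case: Hk => [->|/reflector_orthogonal //]; rewrite trmx1 mulmx1.
have [EE Ed] := embed_reflector_orthogonal (ltnW kr) Hk.
set E := embed_reflector _ in EE Ed.
have WE : W = W' *m E by [].
rewrite -/W' -/E -WE in Wk.
have Wl j (l : 'I_r) : (l < k)%N -> W j l = W' j l.
  move=> lk; rewrite WE mxE (bigD1 l) //= Ed ?lk ?orbT // eqxx mulr1.
  by rewrite big1 ?addr0 // => i il; rewrite Ed ?lk ?orbT // (negbTE il) mulr0.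
have norm_row j : \sum_l W j l ^+ 2 = \sum_l W' j l ^+ 2.
  have E1 (X : 'M[R]_(n, r)) : \sum_l X j l ^+ 2 = (X *m X^T) j j.
    by rewrite mxE; apply: eq_bigr => l _; rewrite mxE.
  by rewrite !E1 WE trmx_mul mulmxA -(mulmxA W') (mulmx1C EE) mulmx1.
(* The reflector preserves the norm of the row and its entries before column [k], and annihilates
   those after it, so the pivot carries all the remaining norm. *)
have Wkk : W (tnth s kk) kk ^+ 2 =
    \sum_(l < r | (k <= l)%N) W' (tnth s kk) l ^+ 2.
  have := norm_row (tnth s kk).
  pose old := [pred l : 'I_r | (l < k)%N].
  rewrite (bigID old) [RHS](bigID old) /=.
  rewrite (eq_bigr (fun l : 'I_r => W' (tnth s kk) l ^+ 2)); last first.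
    by move=> l lk; rewrite Wl.
  move/addrI; under [in RHS]eq_bigl do rewrite -leqNgt.
  move=> <-; rewrite (bigD1 kk) /= ?ltnn // big1 ?addr0 // => l /andP[lk lkk].
  rewrite Wk ?expr0n // ltn_neqAle leqNgt lk andbT eq_sym.
  by apply: contraNneq lkk => lk'; exact/eqP/val_inj.
split.
- exists (Q *m E); last by rewrite WE WQ mulmxA.
  by rewrite trmx_mul mulmxA -(mulmxA Q) (mulmx1C EE) mulmx1.
- move=> i l; rewrite ltnS leq_eqVlt => /orP[/eqP ik|ik] il.
    by rewrite (_ : i = kk) ?Wk -?ik //; exact/val_inj.
  (* A row sampled earlier already vanishes from column [k] on, and on the columns before [k] the
     transformation is the identity, so its zeros survive. *)
  rewrite WE mxE (bigID (fun l : 'I_r => (l < k)%N)) /= addrC big1 ?add0r.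
    rewrite big1 // => j jk; rewrite Ed ?jk //.
    have [jl|] := eqVneq j l; last by rewrite mulr0.
    by rewrite mulr1 jl W0.
  move=> j; rewrite -leqNgt => kj; rewrite W0 ?mul0r //.
  exact: leq_trans kj.
- rewrite Pk PW -EFinM; congr (_%:E).
  rewrite [in RHS](bigD1 kk) //= Wkk /arp_prob ffactnSr natrM invfM.
  rewrite arp_W_take //.
  have -> : \prod_(l < r | (l < k.+1)%N && (l != kk)) W (tnth s l) l ^+ 2 =
            \prod_(l < r | (l < k)%N) W' (tnth s l) l ^+ 2.
    apply: eq_big => [l|l /andP[lk lkk]].
      by rewrite ltnS [(l <= k)%N]leq_eqVlt -val_eqE /=; case: ltngtP.
    by rewrite Wl // ltn_neqAle -ltnS lk andbT; exact: lkk.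
  by rewrite -/W' mulrACA; congr (_ * _); rewrite mulrC.
Qed.

(** At [k = r] the sampled rows of [V *m Q] form a lower triangular matrix, so the product of its
    squared pivots is its squared determinant, and [\det Q ^+ 2 = 1]. *)
Lemma arp_prob_tuple (s : r.-tuple 'I_n) :
  P (J @^-1` [set s]) = (\det (rowsub (tnth s) V) ^+ 2 / (r`!)%:R)%:E.
Proof.
have [[Q QQ WQ] W0] := arp_W_law s (leqnn r).
rewrite -ffactnn => PW; rewrite -[RHS]/(_%:E).
have -> : J @^-1` [set s] = [set w | take r (J w) = take r s].
  apply/seteqP; split=> w /=; first by move=> ->.
  by rewrite !take_oversize ?size_tuple // => /val_inj.
rewrite PW; congr (_ / _)%:E.
have detQ : \det Q ^+ 2 = 1.
  by rewrite expr2 -[X in _ * X]det_tr -det_mulmx QQ det1.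
transitivity (\det (rowsub (tnth s) V) ^+ 2 * \det Q ^+ 2); last first.
  by rewrite detQ mulr1.
rewrite -exprMn -det_mulmx mul_rowsub_mx -WQ.
rewrite det_trig; last first.
  by apply/is_trig_mxP => i j ij; rewrite mxE W0.
rewrite -prodrXl; apply: eq_big => [l|l _]; first by rewrite ltn_ord.
by rewrite mxE.
Qed.
End arp_law.

(** * Spectra of symmetric matrices; nuclear norm and trace *)

Lemma char_poly_conj (R : comUnitRingType) (n : nat) (U C : 'M[R]_n) :
  U \in unitmx -> char_poly (invmx U *m C *m U) = char_poly C.
Proof.
move=> Uu; rewrite /char_poly /char_poly_mx.
have -> : 'X%:M - map_mx polyC (invmx U *m C *m U) =
    map_mx polyC (invmx U) *m ('X%:M - map_mx polyC C) *m map_mx polyC U.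
  rewrite !map_mxM mulmxBr mulmxBl; congr (_ - _).
  by rewrite scalar_mxC -mulmxA -map_mxM mulVmx // map_mx1 mulmx1.
by rewrite !det_mulmx mulrAC -det_mulmx -map_mxM mulVmx // map_mx1 det1 mul1r.
Qed.

Lemma conj_diag_sqr (R : comUnitRingType) (n : nat) (U : 'M[R]_n)
    (D : 'rV[R]_n) :
  U \in unitmx ->
  invmx U *m diag_mx D *m U *m (invmx U *m diag_mx D *m U) =
  invmx U *m diag_mx (\row_i D ord0 i ^+ 2) *m U.
Proof.
move=> Uu; rewrite !mulmxA mulmxK // -(mulmxA (invmx U)) mulmx_diag.
by congr (_ *m _ *m _); apply/matrixP => i j; rewrite !mxE expr2.
Qed.

Lemma psd_eigenvalue_ge0 (R : realType) (n : nat) (A : 'M[R]_n) (a : R) :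
  psdmx A -> eigenvalue A a -> 0 <= a.
Proof.
move=> [_ A0] /eigenvalueP[v vA v0].
have vv : 0 < (v *m v^T) ord0 ord0.
  rewrite lt_neqAle eq_sym; apply/andP; split.
    apply: contra v0 => /eqP; rewrite mxE => /psumr_eq0P vz.
    apply/eqP/rowP => i; rewrite mxE; apply/eqP; rewrite -sqrf_eq0; apply/eqP.
    have := vz _ i isT; rewrite mxE -expr2; apply=> j _.
    by rewrite mxE -expr2 sqr_ge0.
  by rewrite mxE sumr_ge0 // => j _; rewrite mxE -expr2 sqr_ge0.
by have := A0 v^T; rewrite trmxK vA -scalemxAl mxE pmulr_lge0.
Qed.

(** Diagonalisation over [R[i]] yields real eigenvalues, and the identities descend to [R] by
    injectivity of the embedding. A single [d] serves all three, so that the trace can be compared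
    with the singular values, which come from [A *m A]. *)
Lemma symmetric_spectrum (R : realType) (n : nat) (A : 'M[R]_n) :
  A^T = A -> exists d : 'I_n -> R,
    [/\ char_poly A = \prod_i ('X - (d i)%:P),
        char_poly (A *m A) = \prod_i ('X - (d i ^+ 2)%:P) &
        \tr A = \sum_i d i].
Proof.
move=> As; pose f := real_complex R; pose B := map_mx f A.
have Bh : B \is hermsymmx.
  apply: realsym_hermsym.
    by apply/is_hermitianmxP; rewrite expr0 scale1r map_mx_id // /B map_trmx As.
  by apply/mxOverP => i j; rewrite mxE; apply/complex_realP; eexists.
have /orthomx_spectralP := hermitian_normalmx Bh.
have /mxOverP Dr := hermitian_spectral_diag_real Bh.
have := spectral_unit B.
set U := spectralmx B; set D := spectral_diag B in Dr *; move=> Uu BE.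
pose d i := complex.Re (D ord0 i).
have fd i : f (d i) = D ord0 i by rewrite /f /d RRe_real.
have BB : map_mx f (A *m A) = invmx U *m diag_mx (\row_i D ord0 i ^+ 2) *m U.
  by rewrite map_mxM -/B BE; exact: conj_diag_sqr.
exists d; split.
- apply: (map_poly_inj f); rewrite map_char_poly -/B BE char_poly_conj //.
  rewrite char_poly_trig ?diag_mx_is_trig // rmorph_prod /=.
  apply: eq_bigr => i _.
  by rewrite rmorphB /= map_polyX map_polyC /= -/f fd mxE eqxx mulr1n.
- apply: (map_poly_inj f); rewrite map_char_poly BB char_poly_conj //.
  rewrite char_poly_trig ?diag_mx_is_trig // rmorph_prod /=.
  apply: eq_bigr => i _.
  rewrite rmorphB /= map_polyX map_polyC /= -/f !mxE eqxx mulr1n.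
  by rewrite -fd -rmorphXn.
- apply: (fmorph_inj f); rewrite -trace_map_mx -/B BE.
  rewrite mxtrace_mulC mulmxA mulmxV // mul1mx mxtrace_diag rmorph_sum.
  by apply: eq_bigr => i _; exact: esym (fd i).
Qed.

(** The characteristic polynomial of [A^T *m A] splits with roots [d i ^+ 2] and also with the
    squared singular values. The two lists of roots agree up to order, hence so do the sums of their
    square roots; both [d] and the singular values are nonnegative. *)
Lemma nuclear_norm_psd (R : realType) (n : nat) (A : 'M[R]_n) :
  psdmx A -> nuclear_norm A = \tr A.
Proof.
move=> pA; have [As A0] := pA.
have [d [cA cAA ->]] := symmetric_spectrum As.
have d0 i : 0 <= d i.
  apply: (psd_eigenvalue_ge0 pA); rewrite eigenvalue_root_char cA.
  by rewrite /root horner_prod (bigD1 i) //= !hornerE subrr mul0r.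
have := char_poly_singular_values A; rewrite As cAA.
rewrite -(big_map (fun i => d i ^+ 2) xpredT (fun x => 'X - x%:P)).
rewrite -(big_map (fun i => singular_values A ord0 i ^+ 2) xpredT
  (fun x => 'X - x%:P)) => /prod_XsubC_eq p.
have s0 i : 0 <= singular_values A ord0 i by rewrite mxE sqrtr_ge0.
have : \sum_(x <- [seq d i ^+ 2 | i <- index_enum 'I_n]) Num.sqrt x =
       \sum_(x <- [seq singular_values A ord0 i ^+ 2 | i <- index_enum 'I_n])
         Num.sqrt x := perm_big _ p.
rewrite !big_map => E; rewrite /nuclear_norm.
transitivity (\sum_i Num.sqrt (singular_values A ord0 i ^+ 2)).
  by apply: eq_bigr => i _; rewrite sqrtr_sqr ger0_norm.
by rewrite -E; apply: eq_bigr => i _; rewrite sqrtr_sqr ger0_norm.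
Qed.

Lemma psd_congruence (R : realType) (m n : nat) (A : 'M[R]_n)
    (B : 'M[R]_(n, m)) : psdmx A -> psdmx (B^T *m A *m B).
Proof.
move=> [As A0]; split; first by rewrite !trmx_mul trmxK As mulmxA.
by move=> x; have := A0 (B *m x); rewrite trmx_mul !mulmxA.
Qed.

Lemma psd_trace_ge0 (R : realType) (n : nat) (A : 'M[R]_n) :
  psdmx A -> 0 <= \tr A.
Proof.
move=> [_ A0]; apply: sumr_ge0 => i _.
have := A0 (delta_mx i ord0).
by rewrite trmx_delta -rowE -colE !mxE.
Qed.

(** * Variational characterisation of the residual *)

Section residual.
Variables (R : realType) (n r : nat) (A : 'M[R]_n) (s : r.-tuple 'I_n).
Hypothesis pA : psdmx A.
Let S : 'M[R]_(n, r) := colsub (tnth s) 1%:M.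

Let S_tr : S^T = rowsub (tnth s) 1%:M.
Proof. by rewrite trmx_mxsub trmx1. Qed.

Let colsE : cols_of A s = A *m S.
Proof. by rewrite mulmx_colsub mulmx1. Qed.

Let rowsE : rows_of A s = S^T *m A.
Proof. by rewrite S_tr mul_rowsub_mx mul1mx. Qed.

Lemma principal_ofE : principal_of A s = S^T *m A *m S.
Proof. by rewrite S_tr mul_rowsub_mx mul1mx mulmx_colsub mulmx1 -mxsubcr. Qed.

(** Serves twice: for [A], to complete the square, and later for [QAQ], where the cross terms have
    trace zero. *)
Lemma oblique_expand (X : 'M[R]_(r, n)) :
  (1%:M - S *m X)^T *m A *m (1%:M - S *m X) =
  A - cols_of A s *m X - X^T *m rows_of A s + X^T *m principal_of A s *m X.
Proof.
have -> : (1%:M - S *m X)^T = 1%:M - X^T *m S^T.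
  by rewrite raddfB /= trmx1 trmx_mul.
rewrite colsE rowsE principal_ofE.
rewrite mulmxBl mul1mx mulmxBr mulmx1 mulmxBl.
by rewrite !mulmxA opprB [_ - A *m S *m X]addrC !addrA [X in X + _]addrAC.
Qed.

(** Completing the square in [X]: the minimiser is [X0], and the value there is the residual. *)
Lemma oblique_square (X : 'M[R]_(r, n)) : principal_of A s \in unitmx ->
  let X0 := invmx (principal_of A s) *m rows_of A s in
  (1%:M - S *m X)^T *m A *m (1%:M - S *m X) =
  A - cols_of A s *m invmx (principal_of A s) *m rows_of A s +
  (X - X0)^T *m principal_of A s *m (X - X0).
Proof.
move=> Gu X0; rewrite oblique_expand.
have [Gs _] : psdmx (principal_of A s).
  by rewrite principal_ofE; exact: psd_congruence.
set G := principal_of A s in Gu Gs X0 *.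
have rc : (rows_of A s)^T = cols_of A s.
  by rewrite rowsE colsE trmx_mul trmxK pA.1.
have X0t : X0^T = cols_of A s *m invmx G by rewrite trmx_mul rc trmx_inv Gs.
have -> : (X - X0)^T = X^T - X0^T by rewrite raddfB.
rewrite X0t mulmxBl mulmxKV // mulmxBr !mulmxBl /X0 !mulmxA.
rewrite mulmxK // opprB addrCA subrKA [LHS]addrC -[RHS]addrA; congr (_ + _).
by rewrite addrAC addrC.
Qed.

Definition nystrom_residual : 'M[R]_n :=
  A - cols_of A s *m invmx (principal_of A s) *m rows_of A s.

Lemma psd_nystrom_residual :
  principal_of A s \in unitmx -> psdmx nystrom_residual.
Proof.
move=> Gu; have := oblique_square (invmx (principal_of A s) *m rows_of A s) Gu.
rewrite /= subrr trmx0 !mul0mx addr0 -/nystrom_residual => <-.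
exact: psd_congruence.
Qed.

Lemma trace_nystrom_residual_le (X : 'M[R]_(r, n)) :
  principal_of A s \in unitmx ->
  \tr nystrom_residual <= \tr ((1%:M - S *m X)^T *m A *m (1%:M - S *m X)).
Proof.
move=> /(oblique_square X) ->; rewrite /= -/nystrom_residual [leRHS]mxtraceD.
rewrite lerDl; apply: psd_trace_ge0.
by apply: psd_congruence; rewrite principal_ofE; exact: psd_congruence.
Qed.

End residual.

(** * Bound on the residual for a fixed tuple *)

Section bound.
Variables (R : realType) (n r : nat) (A : 'M[R]_n) (V : 'M[R]_(n, r)).
Hypotheses (pA : psdmx A) (VV : orthonormal_cols V).
Let Q : 'M[R]_n := 1%:M - V *m V^T.
Let B := Q *m A *m Q.

Let Q_tr : Q^T = Q.
Proof. by rewrite /Q raddfB /= trmx1 trmx_mul trmxK. Qed.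

Let VQ : V^T *m Q = 0.
Proof. by rewrite mulmxBr mulmx1 mulmxA VV mul1mx subrr. Qed.

Let pB : psdmx B.
Proof. by rewrite /B -{1}Q_tr; exact: psd_congruence. Qed.

(** The squared determinant, proportional to the probability of [s], clears the inverse of [V(s,:)].
    The bound then also covers singular [V(s,:)], where the left side is zero, and can be summed
    over all tuples. *)
Lemma nuclear_nystrom_residual_le (s : r.-tuple 'I_n) :
  principal_of A s \in unitmx ->
  nuclear_norm (nystrom_residual A s) * \det (rowsub (tnth s) V) ^+ 2 <=
  \tr B * \det (rowsub (tnth s) V) ^+ 2 +
  \tr (\adj (rowsub (tnth s) V) *m principal_of B s *m
       (\adj (rowsub (tnth s) V))^T).
Proof.
move=> Gu; rewrite nuclear_norm_psd; last exact: psd_nystrom_residual.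
set W := rowsub _ V; set Z := \adj W; set D := \det W.
have [D0|D0] := eqVneq D 0.
  rewrite D0 expr0n !mulr0 add0r; apply: psd_trace_ge0.
  rewrite -{1}[Z]trmxK; apply: psd_congruence.
  by rewrite principal_ofE; exact: psd_congruence.
have Wu : W \in unitmx by rewrite unitmxE unitfE.
pose S : 'M[R]_(n, r) := colsub (tnth s) 1%:M.
have SV : S^T *m V = W by rewrite /S trmx_mxsub trmx1 mul_rowsub_mx mul1mx.
(* Chosen so that [V^T *m S *m X = V^T]: then [Q] fixes [1%:M - S *m X], and [A] may be replaced by
   [B]. *)
pose X := (invmx W)^T *m V^T.
have VX : V^T *m (1%:M - S *m X) = 0.
  rewrite mulmxBr mulmx1 !mulmxA -[V^T *m S]trmxK trmx_mul trmxK SV.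
  by rewrite -trmx_mul mulVmx // trmx1 mul1mx subrr.
have QX : Q *m (1%:M - S *m X) = 1%:M - S *m X.
  by rewrite {1}/Q mulmxBl mul1mx -mulmxA VX mulmx0 subr0.
have := trace_nystrom_residual_le pA X Gu; rewrite -/S.
have -> : (1%:M - S *m X)^T *m A *m (1%:M - S *m X) =
          (1%:M - S *m X)^T *m B *m (1%:M - S *m X).
  by rewrite -{1}QX -{2}QX trmx_mul Q_tr /B !mulmxA.
have XB : X *m B = 0.
  by rewrite /X /B -!mulmxA (mulmxA V^T) VQ !(mul0mx, mulmx0).
have BX : B *m X^T = 0.
  by apply: (trmx_inj); rewrite trmx_mul trmxK pB.1 XB trmx0.
rewrite /S oblique_expand; rewrite !raddfD !raddfN /=.
have -> : \tr (cols_of B s *m X) = 0.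
  rewrite mxtrace_mulC mulmx_colsub XB.
  by rewrite [X in \tr X](_ : _ = 0) ?mxtrace0 //; apply/matrixP => i j;
     rewrite !mxE.
have -> : \tr (X^T *m rows_of B s) = 0.
  rewrite mxtrace_mulC mul_rowsub_mx BX.
  by rewrite [X in \tr X](_ : _ = 0) ?mxtrace0 //; apply/matrixP => i j;
     rewrite !mxE.
(* Cyclicity brings the outer factors together as [V^T *m V = 1%:M], and the inverse of [W] is [Z]
   divided by [D]. *)
have -> : \tr (X^T *m principal_of B s *m X) =
          D ^- 2 * \tr (Z *m principal_of B s *m Z^T).
  rewrite -mulmxA mxtrace_mulC /X trmx_mul !trmxK -!mulmxA (mulmxA V^T) VV.
  rewrite mul1mx mulmxA mxtrace_mulC /invmx Wu -/Z -/D linearZ /=.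
  by rewrite -scalemxAl -!scalemxAr scalerA mxtraceZ -expr2 exprVn !mulmxA.
rewrite oppr0 !addr0 => le.
rewrite -(ler_pM2r (_ : 0 < D ^+ 2)) in le; last by rewrite exprn_even_gt0.
apply: le_trans le _; rewrite mulrDl lerD2l mulrAC mulVf ?mul1r //.
by rewrite expf_eq0.
Qed.
End bound.

(** * Expectation over the tuples and conclusion *)

(** [F] composed with [J] is a finite combination of indicators of the level sets of [J], and
    nonnegative coefficients allow integration term by term. *)
Lemma expectation_finite (R : realType) (d : measure_display)
    (T : measurableType d) (P : probability T R) (S : finType) (J : T -> S)
    (F : S -> R) :
  (forall s, measurable (J @^-1` [set s])) -> (forall s, 0 <= F s) ->
  ('E_P[fun w => F (J w)] = \sum_s (F s)%:E * P (J @^-1` [set s]))%E.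
Proof.
move=> mJ F0; rewrite unlock.
transitivity (\int[P]_w (\sum_s (F s)%:E * (\1_(J @^-1` [set s]) w)%:E))%E.
  apply: eq_integral => w _; rewrite (bigD1 (J w)) //=.
  rewrite indicE mem_set //= mule1 big1 ?adde0 // => s sJ.
  rewrite indicE memNset ?mule0 //= => Js.
  by rewrite Js eqxx in sJ.
rewrite ge0_integral_sum //.
- apply: eq_bigr => s _; rewrite ge0_integralZl //.
  + by rewrite integral_indic // setIT.
  + by apply/measurable_EFinP; exact: measurable_indic.
  + by rewrite lee_fin.
- move=> s; apply/measurable_EFinP/measurable_funM => //.
- by move=> s w _; rewrite -EFinM lee_fin mulr_ge0.
Qed.

Theorem corollary5p1 (R : realType) (n r : nat)
    (A : 'M[R]_n) (V : 'M[R]_(n, r))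
    (d : measure_display) (T : measurableType d) (P : probability T R)
    (J : T -> r.-tuple 'I_n) :
  psdmx A ->
  orthonormal_cols V ->
  arp_output P V J ->
  {ae P, forall w, principal_of A (J w) \in unitmx} ->
  ('E_P[fun w => nuclear_norm
          (A - cols_of A (J w) *m invmx (principal_of A (J w))
                 *m rows_of A (J w))]
   <= ((r.+1)%:R * nuclear_norm
          ((1%:M - V *m V^T) *m A *m (1%:M - V *m V^T)))%:E)%E.
Proof.
move=> pA VV [mJ [H HR HP]] unitA.
pose F (s : r.-tuple 'I_n) := nuclear_norm (nystrom_residual A s).
rewrite (expectation_finite P (F := F) mJ); last first.
  by move=> s; apply: sumr_ge0 => i _; rewrite mxE sqrtr_ge0.
set Q := 1%:M - V *m V^T.
have Q_tr : Q^T = Q by rewrite /Q raddfB /= trmx1 trmx_mul trmxK.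
have VQ : V^T *m Q = 0 by rewrite mulmxBr mulmx1 mulmxA VV mul1mx subrr.
have pB : psdmx (Q *m A *m Q) by rewrite -{1}Q_tr; exact: psd_congruence.
pose Dt (s : r.-tuple 'I_n) := \det (rowsub (tnth s) V).
pose Z (s : r.-tuple 'I_n) := \adj (rowsub (tnth s) V).
pose b s := \tr (Q *m A *m Q) * Dt s ^+ 2 +
            \tr (Z s *m principal_of (Q *m A *m Q) s *m (Z s)^T).
have b0 s : 0 <= b s.
  apply: addr_ge0; first by rewrite mulr_ge0 ?sqr_ge0 ?psd_trace_ge0.
  apply: psd_trace_ge0; rewrite -{1}[Z s]trmxK; apply: psd_congruence.
  by rewrite principal_ofE; exact: psd_congruence.
rewrite (nuclear_norm_psd pB).
apply: (@le_trans _ _ (\sum_(s : r.-tuple 'I_n) (b s / r`!%:R)%:E)%E).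
  apply: lee_sum => s _; have [Gu|Gu] := boolP (principal_of A s \in unitmx).
    rewrite (arp_prob_tuple HR HP) -EFinM lee_fin mulrA.
    by rewrite ler_wpM2r ?invr_ge0 ?ler0n // nuclear_nystrom_residual_le.
  (* A tuple with singular [A(s,s)] has probability zero, so the default value of [invmx] there is
     harmless and [0 <= b s] suffices. *)
  rewrite measure_negligible // ?mule0 ?lee_fin ?divr_ge0 ?ler0n //.
  by apply: negligibleS unitA => w /= ->; exact/negP.
rewrite sumEFin lee_fin -mulr_suml big_split /= -mulr_sumr.
(* Cauchy-Binet with both matrices equal to [V]: the first term of [b] contributes the trace once,
   the second one [r] times. *)
have -> : \sum_s Dt s ^+ 2 = r`!%:R.
  transitivity (r`!%:R * \det (V^T *m V)); first by rewrite -cauchy_binet_tuple.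
  by rewrite VV det1 mulr1.
have := sum_trace_adj A VV VQ; rewrite Q_tr => ->.
have f0 : (r`!)%:R != 0 :> R by rewrite pnatr_eq0 -lt0n fact_gt0.
rewrite [_ * r`!%:R]mulrC -mulrDr mulrAC mulfV // mul1r.
by rewrite -natr1 mulrDl mul1r addrC.
Qed.
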